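(* Let $R$ be a finite ring such that $R^{\times}=\{1\}$. Then $R$ is a boolean ring, i.e. $x^2=x$ for all $x\in R$.
   Context: Rings are associative with a multiplicative identity $1$, and are not assumed to be commutative. $R^{\times}$ denotes the set of invertible elements (units) of $R$. A ring $R$ is called boolean if every element of $R$ is idempotent, i.e. $x^2=x$ for all $x\in R$. *)

(* Defs.v *)
From HB Require Import structures.
From mathcomp Require Import all_boot all_order all_algebra.
Set Implicit Arguments.
Unset Strict Implicit.
Unset Printing Implicit Defensive.
Import GRing.Theory.
Local Open Scope ring_scope.

(* GRing.unit requires a unitRingType, hence 1 != 0; the two-sided units are
   defined here directly so that the zero ring is not excluded. *)
Definition units (R : finPzRingType) : {set R} :=
  [set x | [exists y, (x * y == 1) && (y * x == 1)]].

Definition boolean_ring (R : pzRingType) : Prop :=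
  forall x : R, x ^+ 2 = x.

(* Main.v *)
(** If z ^+ 2 = 0 then 1 + z is a unit, so R is reduced.  By finiteness
    x ^+ a = x ^+ (a + k) for some k > 0, whence x - x ^+ k.+1 is nilpotent and
    x = x ^+ k.+1.  Then e = x ^+ k is an idempotent acting as the identity on
    the powers of x, and x + (1 - e) is a unit, so x = e. *)

Require Import Defs.
From mathcomp Require Import all_boot all_order all_algebra.
Local Open Scope ring_scope.
Import GRing.Theory.

(** Pigeonhole: [#|R|.+1] exponents share at most [#|R|] values. Writing the period as [k.+1] keeps
    it positive. *)
Lemma exp_collision (R : finPzRingType) (x : R) :
  exists a k, x ^+ a = x ^+ (a + k.+1).
Proof.
have /injectivePn[i [j neq_ij eq_ij]] :
    ~~ injectiveb (fun i : 'I_#|R|.+1 => x ^+ i).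
  by apply/injectiveP => /leq_card; rewrite card_ord ltnn.
wlog lt_ij : i j neq_ij eq_ij / (i < j)%N.
  move=> gen; case: (ltngtP i j) => [|lt_ji|/val_inj eqij]; first exact: gen.
    by apply: (gen j i) => //; rewrite eq_sym.
  by rewrite eqij eqxx in neq_ij.
by exists i, (j - i).-1; rewrite prednK ?subn_gt0 // subnKC // ltnW.
Qed.

Lemma reduced_nilpotent (R : pzRingType) (x : R) n :
  (forall z : R, z ^+ 2 = 0 -> z = 0) -> x ^+ n.+1 = 0 -> x = 0.
Proof.
move=> red; elim: n => [|n IHn]; first by rewrite expr1.
move=> xn0; apply/IHn/red.
(* The square of [x ^+ n.+1] splits as [x ^+ n.+2 * x ^+ n], whose first factor vanishes. *)
by rewrite -exprM mulnC mul2n -addnn addSnnS addnC exprD xn0 mul0r.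
Qed.

Lemma reduced_exp_collision (R : pzRingType) (x : R) a k :
  (forall z : R, z ^+ 2 = 0 -> z = 0) ->
  x ^+ a = x ^+ (a + k) -> x = x ^+ k.+1.
Proof.
move=> red xa; apply/eqP; rewrite -subr_eq0; apply/eqP.
apply: (@reduced_nilpotent _ _ a red).
have -> : x - x ^+ k.+1 = x * (1 - x ^+ k) by rewrite mulrBr mulr1 -exprS.
rewrite exprMn_comm; last by apply: commrB; [apply: commr1|apply: commrX].
(* One factor [1 - x ^+ k] is enough: it turns [x ^+ a] into [x ^+ a - x ^+ (a + k) = 0]. *)
rewrite [X in _ * X]exprS mulrA exprS -(mulrA x) mulrBr mulr1 -exprD -xa.
by rewrite subrr mulr0 mul0r.
Qed.

Lemma trivial_unit_eq1 (R : finPzRingType) (hU : units R = [set 1]) (u v : R) :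
  u * v = 1 -> v * u = 1 -> u = 1.
Proof.
move=> uv vu; apply/set1P; rewrite -hU inE.
by apply/existsP; exists v; rewrite uv vu eqxx.
Qed.

Lemma trivial_units_reduced (R : finPzRingType) (hU : units R = [set 1]) (z : R) :
  z ^+ 2 = 0 -> z = 0.
Proof.
move=> z2; apply: (addrI 1); rewrite addr0.
(* The inverse is the geometric series of [- z], cut off by [z ^+ 2 = 0]. *)
apply: (@trivial_unit_eq1 _ hU _ (1 - z)).
  by rewrite mulrDl mul1r mulrBr mulr1 -expr2 z2 subr0 subrK.
by rewrite mulrBl mul1r mulrDr mulr1 -expr2 z2 addr0 addrK.
Qed.

(* Multiplication in the product of the corner ring e R e with (1 - e) R (1 - e). *)
Lemma mul_add_idempotent_compl (R : pzRingType) (e p q : R) :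
  e * e = e -> p * e = p -> e * q = q ->
  (p + (1 - e)) * (q + (1 - e)) = p * q + (1 - e).
Proof.
move=> ee pe eqq.
have p0 : p * (1 - e) = 0 by rewrite mulrBr mulr1 pe subrr.
have q0 : (1 - e) * q = 0 by rewrite mulrBl mul1r eqq subrr.
have cc : (1 - e) * (1 - e) = 1 - e.
  by rewrite mulrBl mul1r mulrBr mulr1 ee subrr subr0.
by rewrite mulrDl mulrDr p0 mulrDr q0 cc addr0 add0r.
Qed.

Theorem theorem4p3 (R : finPzRingType) (hU : units R = [set 1]) :
  boolean_ring R.
Proof.
move=> x; have [a [k xa]] := exp_collision R x.
have xk := reduced_exp_collision _ _ _ _ (trivial_units_reduced R hU) xa.
(* [y] is the inverse of [x] in the corner ring with identity [e]. The factor [e] matters when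
   [k = 0], where [x ^+ k = 1] may lie outside the corner. *)
pose e := x ^+ k.+1; pose y := x ^+ k * e.
have xe : x * e = x by rewrite -exprS -xk.
have ex : e * x = x by rewrite -exprSr -xk.
have ee : e * e = e by rewrite {1}/e exprSr -mulrA xe -exprSr.
have xy : x * y = e by rewrite mulrA -exprS.
have yx : y * x = e by rewrite -mulrA ex -exprSr.
have ye : y * e = y by rewrite -mulrA ee.
have ey : e * y = y by rewrite mulrA -exprD addnC exprD -mulrA ee.
suff /(canRL (addrK _)) : x + (1 - e) = 1.
  by rewrite subKr => ->; rewrite expr2.
(* Inverses are taken componentwise: [y] for [x] in the corner of [e], and [1 - e] for itself in the
   complementary one. *)
apply: (@trivial_unit_eq1 _ hU _ (y + (1 - e))).
  by rewrite mul_add_idempotent_compl // xy addrC subrK.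
by rewrite mul_add_idempotent_compl // yx addrC subrK.
Qed.
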